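(* Let $m\ge1$ be an integer, $y>0$, and $X\sim\mathrm{CMP}\big((y/m)^m,m\big)$. Then for all integers $n\ge0$, $$m^n\,\mathbb E[X^n]=\frac1{C^{(m)}_0(y)}\sum_{k=0}^n\mathsf S_m(n,k)\,y^k\,C^{(m)}_{k\bmod m}(y)=\frac{V_n(y)}{C^{(m)}_0(y)},$$ where $V_n(x)=\sum_{k=0}^n\mathsf S_m(n,k)\,x^k\,C^{(m)}_{k\bmod m}(x)$. For $m=1$ this is $\mathbb E[X^n]=T_n(y)$, the Touchard polynomial evaluated at the rate $y$.
   Context: The Conway--Maxwell--Poisson distribution $\mathrm{CMP}(\lambda,\nu)$ (with $\lambda,\nu>0$) has probability mass function $$\mathbb P(X=k)=\frac{\lambda^k}{(k!)^\nu Z(\lambda,\nu)},\quad k=0,1,2,\dots,\qquad Z(\lambda,\nu)=\sum_{j=0}^\infty\frac{\lambda^j}{(j!)^\nu}.$$ The convention $0^0=1$ is used. $\mathsf S_m(n,k)$ is defined for $n,k\ge0$ by $\mathsf S_m(0,k)=\delta_{0,k}$, $\mathsf S_m(n,k)=0$ for $k<0$, and $\mathsf S_m(n+1,k)=m\lfloor k/m\rfloor\,\mathsf S_m(n,k)+\mathsf S_m(n,k-1)$ (for $m=1$ these are the classical Stirling numbers of the second kind, and $T_n(x)=\sum_{k=0}^n\mathsf S_1(n,k)x^k$). The hyper-Bessel carriers are $$C^{(m)}_0(x)=\sum_{k=0}^\infty\frac{(x/m)^{mk}}{(k!)^m},\qquad C^{(m)}_r(x)=\sum_{k=0}^\infty\frac{(x/m)^{mk+m-r}}{(k!)^r((k+1)!)^{m-r}}\quad(1\le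 r\le m-1).$$ *)

(* Defs.v *)
From mathcomp Require Import all_boot all_order all_algebra.
From mathcomp Require Import all_classical all_reals all_analysis.

Set Implicit Arguments.
Unset Strict Implicit.
Unset Printing Implicit Defensive.

Import Order.TTheory GRing.Theory Num.Theory.
Import numFieldNormedType.Exports.

Local Open Scope classical_set_scope.
Local Open Scope ring_scope.

(* The series converges for lambda, nu > 0; [limn] is a default value when it
   does not. The exponent nu is real, hence [powR] for (j!)^nu. *)
Definition cmp_Z (R : realType) (lambda nu : R) : R :=
  limn (series (fun j : nat => lambda ^+ j / (j`!)%:R `^ nu)).

Definition cmp_pmf (R : realType) (lambda nu : R) (k : nat) : R :=
  lambda ^+ k / ((k`!)%:R `^ nu * cmp_Z lambda nu).

(* X is real-valued; since the masses at 0, 1, 2, ... add up to 1 for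
   lambda, nu > 0, X is then almost surely a natural number. *)
Definition is_CMP (d : measure_display) (T : measurableType d) (R : realType)
    (P : probability T R) (X : {RV P >-> R}) (lambda nu : R) : Prop :=
  forall k : nat, P (X @^-1` [set k%:R]) = (cmp_pmf lambda nu k)%:E.

(* S_m(n, k), with S_m(n, -1) = 0 built into the match. *)
Fixpoint stirlingm (m n k : nat) : nat :=
  if n is n'.+1 then
    (m * (k %/ m) * stirlingm m n' k
     + (if k is k'.+1 then stirlingm m n' k' else 0))%N
  else (k == 0)%N.

Definition touchard (R : realType) (n : nat) (x : R) : R :=
  \sum_(k < n.+1) (stirlingm 1 n k)%:R * x ^+ k.

(* Only used for r < m, where the subtraction m - r is exact. *)
Definition carrier (R : realType) (m r : nat) (x : R) : R :=
  if r == 0%N then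
    limn (series (fun k : nat => (x / m%:R) ^+ (m * k) / (k`!)%:R ^+ m))
  else
    limn (series (fun k : nat =>
      (x / m%:R) ^+ (m * k + (m - r))
      / ((k`!)%:R ^+ r * ((k.+1)`!)%:R ^+ (m - r)))).

Definition moment_V (R : realType) (m n : nat) (x : R) : R :=
  \sum_(k < n.+1) (stirlingm m n k)%:R * x ^+ k * carrier m (k %% m) x.

(* Main.v *)
Require Import Defs.
From mathcomp Require Import all_boot all_order all_algebra.
From mathcomp Require Import all_classical all_reals all_analysis.
From mathcomp Require Import measurable_realfun ring.

(** Write z = y / m and w j = z^(mj) / (j!)^m, so that the mass of X at j is
    w j divided by the sum of all the weights, which is the carrier of index 0.

    The recurrence of the numbers S_m(n, k) is the one that expands the powers
    of x in the Newton basis with nodes m * floor(i / m), i.e. 0 repeated m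
    times, then m repeated m times, and so on: if N_k(x) is the product over
    i < k of x - m * floor(i / m), then x * N_k = N_(k+1) + m floor(k / m) N_k,
    hence x^n is the sum of the S_m(n, k) N_k(x) ([expn_stirlingm]).  For m = 1
    these are the falling factorials and the classical Stirling numbers.

    Now let x = m j and k = q m + r with r < m.  The product N_k(m j) equals
    m^k (j^_q)^m (j - q)^r ([nodalE]); it vanishes for j < q, and its factor
    (j^_q)^m turns (j!)^m into ((j - q)!)^m.  Summing N_k(m j) w j therefore
    reproduces, after the shift j = q + l, the same kind of series with an
    extra l^r, which is the carrier of index r: the result is y^k times that
    carrier ([nodal_moment]).  By linearity, the sum over j of (m j)^n w j is
    V_n(y) ([cvg_moment_V]).

    On the probabilistic side, the masses add up to 1, so that X is almost
    surely a natural number and its moments are given by the corresponding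
    series ([expectation_discrete]). *)

Set Implicit Arguments.
Unset Strict Implicit.
Unset Printing Implicit Defensive.

Import Order.TTheory GRing.Theory Num.Theory.
Import numFieldNormedType.Exports.

Local Open Scope classical_set_scope.
Local Open Scope ring_scope.

(** * Newton expansion of powers *)

(** The Newton product N_k of the nodes m * floor(i / m), evaluated at m * j.
    Truncated subtraction does no harm: when a true factor is negative, an
    earlier one is zero (see [nodal_eq0]). *)
Definition nodal (m k j : nat) : nat := (\prod_(i < k) (m * (j - i %/ m)))%N.

Lemma nodalS m k j : nodal m k.+1 j = (nodal m k j * (m * (j - k %/ m)))%N.
Proof. by rewrite /nodal big_ord_recr. Qed.

(** The node m * j is the one of index i = j * m, so it is among the first k
    nodes as soon as j * m < k. *)
Lemma nodal_eq0 m k j : (0 < m)%N -> (j * m < k)%N -> nodal m k j = 0%N.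
Proof.
move=> m0 jk; apply/eqP; rewrite /nodal (bigD1 (Ordinal jk)) //=.
by rewrite mulnK // subnn muln0.
Qed.

(** Multiplication by x = m * j in the Newton basis.  This is where the
    recurrence of the generalized Stirling numbers comes from. *)
Lemma mul_nodal m k j : (0 < m)%N ->
  (m * j * nodal m k j = nodal m k.+1 j + m * (k %/ m) * nodal m k j)%N.
Proof.
move=> m0; rewrite nodalS; have [kj|jk] := leqP (k %/ m) j.
  by rewrite -{1}(subnK kj) mulnDr mulnDl; congr addn; rewrite mulnC.
rewrite nodal_eq0 ?muln0 ?mul0n //.
apply: leq_trans (leq_trunc_div k m).
by rewrite ltn_mul2r m0.
Qed.

Lemma stirlingm_small m n k : (n < k)%N -> stirlingm m n k = 0%N.
Proof.
elim: n k => [|n IHn] [|k] //= nk.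
by rewrite !IHn ?muln0 // ltnW.
Qed.

(** Induction on n: multiplying the expansion by m * j and collecting the two
    terms of [mul_nodal] gives the two terms of the recurrence. *)
Lemma expn_stirlingm m n j : (0 < m)%N ->
  ((m * j) ^ n = \sum_(k < n.+1) stirlingm m n k * nodal m k j)%N.
Proof.
move=> m0; elim: n => [|n IHn].
  by rewrite big_ord1 /nodal big_ord0.
rewrite expnS IHn big_distrr /=.
under eq_bigr do rewrite mulnCA mul_nodal // mulnDr.
rewrite big_split /= addnC.
under [in RHS]eq_bigr do rewrite mulnDl.
rewrite big_split /=; congr addn.
  rewrite [RHS]big_ord_recr /= (stirlingm_small _ (ltnSn n)) muln0 mul0n addn0.
  by apply: eq_bigr => i _; rewrite mulnA (mulnC (stirlingm _ _ _)).
by rewrite [RHS]big_ord_recl mul0n add0n.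
Qed.

(** The r <= m nodes that follow the first q * m ones are all equal to m * q. *)
Lemma nodal_block m q r j : (0 < m)%N -> (r <= m)%N ->
  nodal m (q * m + r) j = (nodal m (q * m) j * (m * (j - q)) ^ r)%N.
Proof.
move=> m0 rm; rewrite /nodal big_split_ord /=; congr muln.
rewrite -[r in RHS]card_ord -prod_nat_const; apply: eq_bigr => i _.
by rewrite divnMDl // divn_small ?addn0 // (leq_trans (ltn_ord i)).
Qed.

(** Each complete block of m equal nodes m * i contributes (m * (j - i)) ^ m, and
    the product of j - i over i < q is a falling factorial. *)
Lemma nodalE m q r j : (0 < m)%N -> (r <= m)%N ->
  nodal m (q * m + r) j = (m ^ (q * m + r) * (j ^_ q) ^ m * (j - q) ^ r)%N.
Proof.
move=> m0 rm; rewrite nodal_block // expnMn expnD.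
suff -> : nodal m (q * m) j = (m ^ (q * m) * (j ^_ q) ^ m)%N.
  by rewrite !mulnA; congr muln; rewrite mulnAC.
elim: q => [|q IHq].
  by rewrite /nodal mul0n big_ord0 ffactn0 exp1n.
rewrite mulSn addnC nodal_block // IHq ffactnSr !expnMn expnD.
by rewrite !mulnA; congr muln; rewrite mulnAC.
Qed.

(** * Series *)

Lemma leq_fact_prod m r k : (0 < m)%N -> (r <= m)%N ->
  (k`! <= k`! ^ r * k.+1`! ^ (m - r))%N.
Proof.
move=> m0 rm; apply: (@leq_trans (k`! ^ m)%N).
  by rewrite -{1}[k`!]expn1 leq_pexp2l // fact_gt0.
rewrite -{1}(subnKC rm) expnD leq_mul2l; apply/orP; right.
by case: (m - r)%N => // e; rewrite leq_exp2r // factS leq_pmull.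
Qed.

Section Series.
Variable R : realType.
Implicit Types (u : R ^nat) (c l : R).

Lemma cvg_seriesZ c u l :
  series u @ \oo --> l -> series (fun j => c * u j) @ \oo --> c * l.
Proof.
move=> ul; have -> : series (fun j => c * u j) = fun n => c * series u n.
  by apply/funext => n; rewrite /series /= mulr_sumr.
by apply: cvgM => //; exact: cvg_cst.
Qed.

Lemma cvg_series_sum N (u : nat -> R ^nat) (l : nat -> R) :
  (forall k, series (u k) @ \oo --> l k) ->
  series (fun j => \sum_(k < N) u k j) @ \oo --> \sum_(k < N) l k.
Proof.
move=> ul.
have -> : series (fun j => \sum_(k < N) u k j)
    = fun n => \sum_(k < N) series (u k) n.
  by apply/funext => n; rewrite /series /= exchange_big.
by apply: cvg_big => [|k _]; [exact: add_continuous|exact: ul].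
Qed.

Lemma eseries_EFin (u : R ^nat) (l : R) : series u @ \oo --> l ->
  (\sum_(0 <= k <oo) (u k)%:E = l%:E)%E.
Proof.
move=> ul; rewrite -(cvg_lim (@Rhausdorff R) ul) -EFin_lim; last exact: cvgP ul.
by congr (limn _); apply/funext => n; rewrite /= sumEFin.
Qed.

(** A shift without boundary terms; it is applied to the Newton products, which
    vanish at the first naturals. *)
Lemma cvg_series_shift q u l : (forall i, (i < q)%N -> u i = 0) ->
  series (fun j => u (q + j)%N) @ \oo --> l -> series u @ \oo --> l.
Proof.
move=> u0 ul; rewrite -(cvg_shiftn q).
have -> : [sequence series u (n + q)%N]_n = series (fun j => u (q + j)%N).
  apply/funext => n; rewrite /series /= (@big_cat_nat _ _ _ q) ?leq_addl //=.
  rewrite big_nat big1 ?add0r => [|i /andP[_ iq]]; last exact: u0.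
  by rewrite -{1}[q]add0n big_addn addnK; under eq_bigr do rewrite addnC.
exact: ul.
Qed.

(** Both factorial powers together dominate a single k!, so the exponential
    series of z^m majorizes the series.  The carrier of index 0 is the case
    r = m, b = 0. *)
Lemma is_cvg_carrier m r b (z : R) : (0 < m)%N -> (r <= m)%N -> 0 <= z ->
  cvgn (series (fun k : nat => z ^+ (m * k + b)
    / ((k`!)%:R ^+ r * ((k.+1)`!)%:R ^+ (m - r)))).
Proof.
move=> m0 rm z0.
apply: (@series_le_cvg _ _ (fun k => z ^+ b * exp_coeff (z ^+ m) k)).
- by move=> k; rewrite divr_ge0 ?mulr_ge0 ?exprn_ge0.
- by move=> k; rewrite mulr_ge0 ?exp_coeff_ge0 ?exprn_ge0.
- move=> k; rewrite /exp_coeff /= addnC exprD exprM -mulrA.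
  rewrite ler_wpM2l ?exprn_ge0 // ler_wpM2l ?exprn_ge0 //.
  rewrite lef_pV2 ?posrE ?mulr_gt0 ?exprn_gt0 ?ltr0n ?fact_gt0 //.
  by rewrite -!natrX -natrM ler_nat leq_fact_prod.
- have /cvg_ex[l ul] := is_cvg_series_exp_coeff (z ^+ m).
  by apply/cvg_ex; exists (z ^+ b * l); exact: cvg_seriesZ.
Qed.

End Series.

(** * Moments of the Conway-Maxwell-Poisson weights *)

Section Moments.
Variables (R : realType) (m : nat) (y : R).
Hypotheses (m0 : (0 < m)%N) (y0 : 0 < y).

Let z := y / m%:R.
Let w (j : nat) : R := z ^+ (m * j) / (j`!)%:R ^+ m.

Let z0 : 0 < z. Proof. by rewrite divr_gt0 ?ltr0n. Qed.

Let yE : y = z * m%:R.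
Proof. by rewrite divfK // pnatr_eq0 -lt0n. Qed.

Let w_ge0 j : 0 <= w j.
Proof. by rewrite divr_ge0 ?exprn_ge0 // ltW. Qed.

Lemma cvg_carrier0 : series w @ \oo --> carrier m 0 y.
Proof.
have := @is_cvg_carrier R m m 0 z m0 (leqnn m) (ltW z0); rewrite subnn.
by under eq_fun do rewrite addn0 expr0 mulr1.
Qed.

Lemma cvg_carrier r : (0 < r < m)%N ->
  series (fun k : nat => z ^+ (m * k + (m - r))
    / ((k`!)%:R ^+ r * ((k.+1)`!)%:R ^+ (m - r))) @ \oo --> carrier m r y.
Proof.
move=> /andP[r0 rm]; rewrite /carrier gtn_eqF //.
exact: is_cvg_carrier (ltnW rm) (ltW z0).
Qed.

Lemma carrier0_gt0 : 0 < carrier m 0 y.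
Proof.
have w_nd : nondecreasing_seq (series w) by apply: nondecreasing_series.
apply: lt_le_trans (nondecreasing_cvgn_le w_nd (cvgP _ cvg_carrier0) 1%N).
rewrite /series /= big_nat1 /w muln0 expr0 fact0 expr1n divr1.
exact: ltr01.
Qed.

(** Since (q + l)! = (q + l)^_q * l!, the m-th power of the falling factorial
    in the Newton product cancels against the weight at q + l and leaves the
    weight at l.  The powers of m turn the remaining powers of z into powers of
    y, except for the last r, which are left as m ^ r. *)
Lemma nodal_weight q r l : (r <= m)%N ->
  (nodal m (q * m + r) (q + l))%:R * w (q + l)%N
    = y ^+ (q * m) * (m%:R ^+ r * l%:R ^+ r * w l).
Proof.
move=> rm; rewrite nodalE // addKn /w -(@ffact_fact (q + l) q) ?leq_addr //.
rewrite addKn yE; clearbody z.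
have f0 : (((q + l) ^_ q)%:R : R) != 0.
  by rewrite pnatr_eq0 -lt0n ffact_gt0 leq_addr.
have g0 : (l`!%:R : R) != 0 by rewrite pnatr_eq0 -lt0n fact_gt0.
rewrite !natrM !natrX !exprMn mulnDr !exprD (mulnC m q).
have := expf_neq0 m f0; have := expf_neq0 m g0.
move: (l`!%:R ^+ m) (_%:R ^+ m) => F G F0 G0.
by field; rewrite F0 G0.
Qed.

(** Shifting by q removes the vanishing terms and leaves the sum of l^r w l.
    For r = 0 it is the carrier of index 0.  For r > 0 the term l = 0 also
    vanishes, and l = s + 1 gives l^r / (l!)^m = 1 / ((s!)^r ((s+1)!)^(m-r)),
    the coefficients of the carrier of index r. *)
Lemma nodal_moment k :
  series (fun j => (nodal m k j)%:R * w j) @ \oo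
    --> y ^+ k * carrier m (k %% m) y.
Proof.
rewrite {1 2}(divn_eq k m); have rm := ltn_pmod k m0.
move: (k %/ m)%N (k %% m)%N rm => q r rm.
have small i : (i < q)%N -> (nodal m (q * m + r) i)%:R * w i = 0.
  move=> iq; rewrite nodal_eq0 ?mul0r //.
  by rewrite (@leq_trans (q * m)) ?leq_addr // ltn_mul2r m0.
apply: cvg_series_shift small _.
under eq_fun do rewrite nodal_weight 1?ltnW //.
rewrite exprD -mulrA; apply: cvg_seriesZ.
case: r rm => [|r] rm.
  under eq_fun do rewrite !expr0 !mul1r.
  by rewrite mul1r; exact: cvg_carrier0.
apply: (@cvg_series_shift _ 1) => [[|//] _|].
  by rewrite [0 ^+ _]expr0n /= mulr0 mul0r.
rewrite [X in series X](_ : _ = fun s => y ^+ r.+1 *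
    (z ^+ (m * s + (m - r.+1))
     / ((s`!)%:R ^+ r.+1 * ((s.+1)`!)%:R ^+ (m - r.+1)))).
  by apply: cvg_seriesZ; apply: cvg_carrier.
apply/funext => s; rewrite add1n /w.
rewrite yE; clearbody z.
(* m powers of z: r + 1 of them pair with powers of m to form powers of y. *)
have -> : (m * s.+1 = r.+1 + (m * s + (m - r.+1)))%N.
  by rewrite addnCA (subnKC (ltnW rm)) mulnSr.
have -> : (s.+1`!%:R ^+ m : R)
    = s.+1%:R ^+ r.+1 * s`!%:R ^+ r.+1 * s.+1`!%:R ^+ (m - r.+1).
  by rewrite -{1}(subnKC (ltnW rm)) exprD -exprMn -natrM.
rewrite exprMn [z ^+ (r.+1 + _)]exprD.
have s1 : (s.+1%:R : R) != 0 by rewrite pnatr_eq0.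
have f0 : (s`!%:R : R) != 0 by rewrite pnatr_eq0 -lt0n fact_gt0.
have g0 : (s.+1`!%:R : R) != 0 by rewrite pnatr_eq0 -lt0n fact_gt0.
have := expf_neq0 r.+1 s1; have := expf_neq0 r.+1 f0.
have := expf_neq0 (m - r.+1) g0.
move: (s.+1`!%:R ^+ (m - r.+1)) (s`!%:R ^+ r.+1) (s.+1%:R ^+ r.+1).
by move=> A B C A0 B0 C0; field; rewrite A0 B0 C0.
Qed.

Lemma cvg_moment_V n :
  series (fun j => ((m * j) ^ n)%:R * w j) @ \oo --> moment_V m n y.
Proof.
rewrite [X in series X](_ : _ = fun j => \sum_(k < n.+1)
    (stirlingm m n k)%:R * ((nodal m k j)%:R * w j)).
  apply: (@cvg_series_sum _ _ (fun k j =>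
    (stirlingm m n k)%:R * ((nodal m k j)%:R * w j))
    (fun k => (stirlingm m n k)%:R * y ^+ k * carrier m (k %% m) y)) => k.
  by rewrite -mulrA; apply: cvg_seriesZ; exact: nodal_moment.
apply/funext => j; rewrite expn_stirlingm // natr_sum mulr_suml.
by apply: eq_bigr => k _; rewrite natrM mulrA.
Qed.

Lemma cmp_ZE : cmp_Z (z ^+ m) m%:R = carrier m 0 y.
Proof.
rewrite /cmp_Z /carrier /=; congr (limn (series _)); apply/funext => j.
by rewrite powR_mulrn // exprM.
Qed.

Lemma cmp_pmfE k : cmp_pmf (z ^+ m) m%:R k = (carrier m 0 y)^-1 * w k.
Proof.
by rewrite /cmp_pmf cmp_ZE powR_mulrn // -exprM invfM mulrA mulrC.
Qed.

Lemma cvg_cmp_moment n :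
  series (fun k => cmp_pmf (z ^+ m) m%:R k * (m%:R * k%:R) ^+ n) @ \oo
    --> (carrier m 0 y)^-1 * moment_V m n y.
Proof.
under eq_fun do rewrite cmp_pmfE -natrM -natrX -mulrA [w _ * _]mulrC.
by apply: cvg_seriesZ; exact: cvg_moment_V.
Qed.

Lemma cvg_cmp_pmf : series (cmp_pmf (z ^+ m) m%:R) @ \oo --> (1 : R).
Proof.
rewrite (funext cmp_pmfE) -(mulVf (lt0r_neq0 carrier0_gt0)).
by apply: cvg_seriesZ; exact: cvg_carrier0.
Qed.

End Moments.

(** * Expectations of discrete random variables *)

Section Discrete.
Context (d : measure_display) (T : measurableType d) (R : realType).
Variables (P : probability T R) (X : {RV P >-> R}) (p : R ^nat).
Hypothesis Xp : forall k : nat, P (X @^-1` [set k%:R]) = (p k)%:E.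
Hypothesis p1 : series p @ \oo --> (1 : R).

Let F (k : nat) : set T := X @^-1` [set k%:R].
Let D : set T := \bigcup_k F k.

Let PF k : P (F k) = (p k)%:E := Xp k.

Let mF k : measurable (F k).
Proof. by rewrite -[F k]setTI; exact: measurable_funP. Qed.

Let tF : trivIset setT F.
Proof.
move=> i j _ _ [t [/= Fi Fj]]; apply/eqP.
by rewrite -(eqr_nat R) -Fi -Fj.
Qed.

Let mD : measurable D. Proof. exact: bigcup_measurable. Qed.

(** The masses p k exhaust the total probability, so the values k carry all of
    it. *)
Lemma discrete_support : P (~` D) = 0%E.
Proof.
have PD : P D = 1%E.
  rewrite measure_semi_bigcup // -(eseries_EFin p1).
  by apply: eq_eseriesr => k _; exact: PF.
by rewrite probability_setC // PD subee.
Qed.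

(** Off the naturals g may be replaced by 0 without changing the integral; the
    new integrand is nonnegative, so its integral splits along the level sets
    of X by monotone convergence. *)
Lemma expectation_discrete (g : R -> R) (l : R) :
  measurable_fun setT g -> (forall k : nat, 0 <= g k%:R) ->
  series (fun k => p k * g k%:R) @ \oo --> l ->
  ('E_P[g \o X] = l%:E)%E.
Proof.
move=> mg g0 gl; rewrite unlock.
have mgX : measurable_fun setT (EFin \o (g \o X)).
  by apply/measurable_EFinP; exact: measurableT_comp.
rewrite (ae_eq_integral ((EFin \o (g \o X)) \_ D)) //; last 2 first.
- by apply/measurable_restrict => //; exact: measurable_funTS.
- exists (~` D); split; [exact: measurableC|exact: discrete_support|].
  by move=> t /= gt Dt; apply: gt => _; rewrite patchE mem_set.
rewrite -integral_mkcond ge0_integral_bigcup //; last 2 first.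
- exact: measurable_funTS.
- by move=> t [k _ /= ->]; rewrite lee_fin.
rewrite -(eseries_EFin gl); apply: eq_eseriesr => k _.
rewrite (eq_integral (cst (g k%:R)%:E)); last by move=> t /set_mem /= ->.
by rewrite integral_cst // EFinM muleC -PF.
Qed.

End Discrete.

Theorem theorem8p3 (R : realType) (m : nat) (y : R)
    (d : measure_display) (T : measurableType d) (P : probability T R)
    (X : {RV P >-> R}) :
  (1 <= m)%N -> 0 < y -> is_CMP X ((y / m%:R) ^+ m) m%:R ->
  forall n : nat,
    [/\ ((m%:R ^+ n)%:E * 'E_P[fun w => (X w ^+ n)%R])%E
          = ((carrier m 0 y)^-1
             * \sum_(k < n.+1)
                 (stirlingm m n k)%:R * y ^+ k * carrier m (k %% m) y)%:E,
        (carrier m 0 y)^-1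
             * \sum_(k < n.+1)
                 (stirlingm m n k)%:R * y ^+ k * carrier m (k %% m) y
          = moment_V m n y / carrier m 0 y
      & m = 1%N -> ('E_P[fun w => (X w ^+ n)%R] = (touchard n y)%:E)%E].
Proof.
move=> m0 y0 Xp n.
have C0 := lt0r_neq0 (carrier0_gt0 m0 y0).
have E : ((m%:R ^+ n)%:E * 'E_P[fun w => (X w ^+ n)%R])%E
    = ((carrier m 0 y)^-1 * moment_V m n y)%:E.
  have mn0 : (m%:R ^+ n : R) != 0 by rewrite expf_neq0 // pnatr_eq0 -lt0n.
  rewrite (@expectation_discrete _ _ _ P X _ Xp (cvg_cmp_pmf m0 y0)
    (fun x => x ^+ n) ((m%:R ^+ n)^-1 * ((carrier m 0 y)^-1 * moment_V m n y))).
  - by rewrite -EFinM mulVKf.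
  - exact: measurable_funX.
  - by move=> k; exact: exprn_ge0.
  rewrite [X in series X](_ : _ = fun k => (m%:R ^+ n)^-1
      * (cmp_pmf ((y / m%:R) ^+ m) m%:R k * (m%:R * k%:R) ^+ n)).
    by apply: cvg_seriesZ; exact: cvg_cmp_moment.
  by apply/funext => k; rewrite [(_ * k%:R) ^+ n]exprMn mulrCA mulKf.
split => [||m1]; [exact: E|by rewrite mulrC|].
(* For m = 1 every carrier has index 0 and cancels with the normalization. *)
subst m; move: E; rewrite expr1n mul1e => ->; congr EFin.
rewrite /moment_V /touchard mulr_sumr; apply: eq_bigr => k _.
by rewrite modn1 mulrCA mulVf ?mulr1.
Qed.
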